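(* Let $(Z,d_Z)$ be a complete separable metric space, $z_0\in Z$, $p\in[1,\infty]$, and let $(X,\omega_X,\mu_X)$, $(Y,\omega_Y,\mu_Y)$ be $(Z,p)$-networks. Let $C(x,y)=\mathrm{W}_p\big(\omega_X(x,\cdot)_*\mu_X,\ \omega_Y(y,\cdot)_*\mu_Y\big)$ for $(x,y)\in X\times Y$. Then $$\begin{aligned} \mathrm{GW}_p^Z(X,Y)&\ge \tfrac12\inf_{\pi\in\mathcal{C}(\mu_X,\mu_Y)}\|\mathrm{ecc}^{\mathrm{out}}_{p,X,Y}\|_{L^p(\pi)}\\ &=\tfrac12\inf_{\pi\in\mathcal{C}(\mu_X,\mu_Y)}\|C\|_{L^p(\pi)}\\ &\ge\tfrac12\inf_{\pi\in\mathcal{C}(\mu_X,\mu_Y)}\|\mathrm{ecc}^{\mathrm{out}}_{p,z_0,X}-\mathrm{ecc}^{\mathrm{out}}_{p,z_0,Y}\|_{L^p(\pi)}\\ &=\tfrac12\mathrm{W}_p\big((\mathrm{ecc}^{\mathrm{out}}_{p,z_0,X})_*\mu_X,(\mathrm{ecc}^{\mathrm{out}}_{p,z_0,Y})_*\mu_Y\big)\\ &\ge\tfrac12\big|\mathrm{size}_{p,z_0}(X)-\mathrm{size}_{p,z_0}(Y)\big|, \end{aligned}$$ and $$\begin{aligned} \mathrm{GW}_p^Z(X,Y)&\ge\tfrac12\inf_{\sigma\in\mathcal{C}(\mu_X\otimes\mu_X,\mu_Y\otimes\mu_Y)}\|d_Z(\omega_X,\omega_Y)\|_{L^p(\sigma)}\\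 &=\tfrac12\mathrm{W}_p\big((\omega_X)_*(\mu_X\otimes\mu_X),(\omega_Y)_*(\mu_Y\otimes\mu_Y)\big). \end{aligned}$$ The first chain also holds with the incoming functions $\mathrm{ecc}^{\mathrm{in}}_{p,X,Y}$, $\mathrm{ecc}^{\mathrm{in}}_{p,z_0,X}$, $\mathrm{ecc}^{\mathrm{in}}_{p,z_0,Y}$ in place of the outgoing ones and $C(x,y)$ replaced by $\mathrm{W}_p(\omega_X(\cdot,x)_*\mu_X,\omega_Y(\cdot,y)_*\mu_Y)$.
   Context: A $(Z,p)$-network is a triple $(X,\omega_X,\mu_X)$ where $X$ is a Polish space, $\mu_X$ is a Borel probability measure on $X$, and $\omega_X:X\times X\to Z$ is measurable with $\|d_Z(\omega_X(\cdot,\cdot),z_0)\|_{L^p(\mu_X\otimes\mu_X)}<\infty$ for some (equivalently every) $z_0\in Z$. $\mathcal{C}(\mu,\nu)$ is the set of couplings of $\mu$ and $\nu$. Define $$\mathrm{GW}_p^Z(X,Y)=\tfrac12\inf_{\pi\in\mathcal{C}(\mu_X,\mu_Y)}\big\|(x,y,x',y')\mapsto d_Z(\omega_X(x,x'),\omega_Y(y,y'))\big\|_{L^p(\pi\otimes\pi)}.$$ For $p=\infty$, $L^p$-norms are essential suprema. For Borel probability measures $\mu,\nu$ on a Polish metric space $(S,d_S)$, $\mathrm{W}_p(\mu,\nu)=\inf_{\pi\in\mathcal{C}(\mu,\nu)}\|d_S\|_{L^p(\pi)}$; it is taken on $(Z,d_Z)$, except for the pushforwards under eccentricities of a single network, where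 it is taken on $\mathbb{R}$ with its standard metric. Invariants: - $\mathrm{size}_{p,z_0}(X)=\|d_Z(\omega_X(\cdot,\cdot),z_0)\|_{L^p(\mu_X\otimes\mu_X)}$; - $\mathrm{ecc}^{\mathrm{out}}_{p,X,Y}(x,y)=\inf_{\pi\in\mathcal{C}(\mu_X,\mu_Y)}\|d_Z(\omega_X(x,\cdot),\omega_Y(y,\cdot))\|_{L^p(\pi)}$ and $\mathrm{ecc}^{\mathrm{in}}_{p,X,Y}(x,y)=\inf_{\pi\in\mathcal{C}(\mu_X,\mu_Y)}\|d_Z(\omega_X(\cdot,x),\omega_Y(\cdot,y))\|_{L^p(\pi)}$; - $\mathrm{ecc}^{\mathrm{out}}_{p,z_0,X}(x)=\|d_Z(\omega_X(x,\cdot),z_0)\|_{L^p(\mu_X)}$ and $\mathrm{ecc}^{\mathrm{in}}_{p,z_0,X}(x)=\|d_Z(\omega_X(\cdot,x),z_0)\|_{L^p(\mu_X)}$, and likewise for $Y$; these are finite for almost every point. In $\|\mathrm{ecc}^{\mathrm{out}}_{p,z_0,X}-\mathrm{ecc}^{\mathrm{out}}_{p,z_0,Y}\|_{L^p(\pi)}$ the function is $(x,y)\mapsto \mathrm{ecc}^{\mathrm{out}}_{p,z_0,X}(x)-\mathrm{ecc}^{\mathrm{out}}_{p,z_0,Y}(y)$; in $\|d_Z(\omega_X,\omega_Y)\|_{L^p(\sigma)}$ the function is $((x,x'),(y,y'))\mapsto d_Z(\omega_X(x,x'),\omega_Y(y,y'))$. *)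

(* Defs.v *)
From HB Require Import structures.
From mathcomp Require Import all_boot all_order all_algebra.
From mathcomp Require Import all_classical all_reals all_analysis.
From mathcomp Require Import measurable_realfun ess_sup_inf.

Set Implicit Arguments.
Unset Strict Implicit.
Unset Printing Implicit Defensive.

Import Order.TTheory GRing.Theory Num.Theory.
Import numFieldNormedType.Exports.

Local Open Scope classical_set_scope.
Local Open Scope ring_scope.
Local Open Scope ereal_scope.

#[short(type="completeMetricType")]
HB.structure Definition CompleteMetric (R : numDomainType) :=
  {M of Complete M & Metric R M}.

HB.instance Definition _ (R : realType) := Metric.on R^o.

Definition separable (T : topologicalType) : Prop :=
  exists2 D : set T, countable D & dense D.

(* The complete metric is carried by a space M homeomorphic to T, so that the
   topology of T is the one induced by the metric pulled back from M. *)
Definition polish (R : realType) (T : topologicalType) : Prop :=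
  separable T /\
  exists (M : completeMetricType R) (f : T -> M) (g : M -> T),
    [/\ cancel f g, cancel g f, continuous f & continuous g].

(* For separable metrizable T, the product sigma-algebra on
   borel T * borel T is the Borel sigma-algebra of the product topology. *)
Notation borel T := (g_sigma_algebraType (@open T)).

Section coupling.
Context {d1 d2 : measure_display} {T1 : measurableType d1}
  {T2 : measurableType d2} {R : realType}.

(* Marginals are compared on measurable sets only: a [probability] is a
   function on all sets, unconstrained outside the sigma-algebra. *)
Definition coupling (mu : probability T1 R) (nu : probability T2 R) :
    set (probability (T1 * T2)%type R) :=
  [set pi | (forall A, measurable A -> pi (fst @^-1` A) = mu A) /\
            (forall B, measurable B -> pi (snd @^-1` B) = nu B)].

Definition inf_coupling (p : \bar R) (mu : probability T1 R)
    (nu : probability T2 R) (f : T1 * T2 -> \bar R) : \bar R :=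
  ereal_inf [set 'N[pi]_p[f] | pi in coupling mu nu].

End coupling.

Definition Wasserstein {R : realType} {S : completeMetricType R} (p : \bar R)
    (mu nu : probability (borel S) R) : \bar R :=
  inf_coupling p mu nu (fun u => (@mdist R S u.1 u.2)%:E).

Section sections.
Context {d1 d2 d3 : measure_display} {T1 : measurableType d1}
  {T2 : measurableType d2} {T3 : measurableType d3}.
Variable f : {mfun (T1 * T2)%type >-> T3}.

Definition lsection (x : T1) (y : T2) : T3 := f (x, y).

Definition rsection (y : T2) (x : T1) : T3 := f (x, y).

Let measurable_lsection x : measurable_fun setT (lsection x).
Proof. by apply: measurable_fun_pair2; exact: measurable_funPT. Qed.

HB.instance Definition _ x :=
  isMeasurableFun.Build _ _ _ _ (lsection x) (measurable_lsection x).

Let measurable_rsection y : measurable_fun setT (rsection y).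
Proof. by apply: measurable_fun_pair1; exact: measurable_funPT. Qed.

HB.instance Definition _ y :=
  isMeasurableFun.Build _ _ _ _ (rsection y) (measurable_rsection y).

End sections.

Record network (R : realType) (Z : completeMetricType R) (p : \bar R) :=
  Network {
    carrier :> ptopologicalType ;
    carrier_polish : polish R carrier ;
    mu : probability (borel carrier) R ;
    omega : {mfun (borel carrier * borel carrier)%type >-> borel Z} ;
    omega_Lp : exists z0 : Z,
      'N[(mu \x mu)]_p[(fun u => (@mdist R Z (omega u) z0)%:E)] < +oo
  }.

Section measurability.
Context {d1 d2 : measure_display} {T1 : measurableType d1}
  {T2 : measurableType d2} {R : realType}.

Lemma measurable_ess_sup (m : probability T2 R) (f : T1 * T2 -> \bar R) :
  measurable_fun setT f ->
  measurable_fun setT (fun x => ess_sup m (fun y => f (x, y))).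
Proof.
move=> mf.
apply: (measurability _ (ErealGenOInfty.measurableE R)) => // _ [_ [r ->] <-].
rewrite setTI.
pose A := f @^-1` `]r%:E, +oo[.
have mA : measurable A by rewrite -[A]setTI; apply: mf => //; exact: emeasurable_itv.
have -> : (fun x => ess_sup m (fun y => f (x, y))) @^-1` `]r%:E, +oo[ =
    (m \o xsection A) @^-1` ~` [set 0].
  apply/seteqP; split=> x /=; rewrite in_itv/= andbT ltNge.
    move=> /negP h m0; apply: h; apply/ess_supP/ae_le_measureP.
      exact: measurable_fun_pair2.
    by rewrite -m0; congr (m _); apply/seteqP; split=> y; rewrite /xsection/= inE.
  move=> h; apply/negP => /ess_supP/ae_le_measureP m0; apply: h.
  rewrite -[RHS]m0; last exact: measurable_fun_pair2.
  by congr (m _); apply/seteqP; split=> y; rewrite /xsection/= inE.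
rewrite -[X in measurable X]setTI.
apply: (measurable_fun_xsection m mA) => //.
by apply: measurableC; exact: emeasurable_set1.
Qed.

Lemma measurable_Lnorm_lsection (m : probability T2 R) (p : \bar R)
    (f : T1 * T2 -> \bar R) : measurable_fun setT f ->
  measurable_fun setT (fun x => 'N[m]_p[(fun y => f (x, y))]).
Proof.
move=> mf; rewrite unlock; case: p => [r| |] /=.
- apply: (measurableT_comp (measurable_poweR _)).
  apply: (measurable_fun_fubini_tonelli_F (m2 := m)
    (fun z => `|f z| `^ r)).
    apply: (measurableT_comp (measurable_poweR _)).
    exact: measurableT_comp.
  by move=> z; exact: poweR_ge0.
- rewrite probability_setT lte01; apply: (@measurable_ess_sup m (abse \o f)).
  exact: measurableT_comp.
- rewrite probability_setT lte01; under eq_fun do rewrite ess_infEN.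
  apply: measurableT_comp => //.
  apply: (@measurable_ess_sup m (\- (abse \o f))).
  by apply: measurableT_comp => //; exact: measurableT_comp.
Qed.

End measurability.

Lemma measurable_mdist {R : realType} {Z : completeMetricType R} (z0 : Z) :
  measurable_fun [set: borel Z] (fun z => (@mdist R Z z z0)%:E).
Proof.
apply/measurable_EFinP.
apply: (measurability _ (RGenInftyO.measurableE R)) => // _ [_ [r ->] <-].
rewrite setTI; apply: sub_sigma_algebra => /=.
rewrite openE => z /=; rewrite in_itv/= => zr; apply/nbhs_ballP.
exists (r - @mdist R Z z z0)%R => /=; first by rewrite subr_gt0.
move=> y; rewrite ballEmdist/= in_itv/= => zy.
rewrite (le_lt_trans (metric_triangle y z z0))// metric_sym.
by rewrite -ltrBrDr.
Qed.

Lemma measurable_borel_real d (T : measurableType d) (R : realType)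
    (f : T -> R) : measurable_fun setT f ->
  @measurable_fun _ _ T (borel R^o) setT f.
Proof.
move=> mf; apply: (@measurability _ _ T (borel R^o) _ _ (@open R^o)) => // _ [B oB <-].
by apply: mf => //; exact: open_measurable.
Qed.

Unset Implicit Arguments.

Section invariants.
Context {R : realType} {Z : completeMetricType R} {p : \bar R}.
Implicit Types X Y : network Z p.

Local Notation dZ z z' := (@mdist R Z z z')%:E.

Definition GW X Y : \bar R :=
  2^-1%:E * ereal_inf
    [set 'N[(pi \x pi)]_p[(fun u =>
           dZ (omega X (u.1.1, u.2.1)) (omega Y (u.1.2, u.2.2)))]
      | pi in coupling (mu X) (mu Y)].

Definition size_at (z0 : Z) X : \bar R :=
  'N[(mu X \x mu X)]_p[(fun u => dZ (omega X u) z0)].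

Definition ecc2_out X Y (u : borel X * borel Y) : \bar R :=
  inf_coupling p (mu X) (mu Y)
    (fun v => dZ (omega X (u.1, v.1)) (omega Y (u.2, v.2))).

Definition ecc2_in X Y (u : borel X * borel Y) : \bar R :=
  inf_coupling p (mu X) (mu Y)
    (fun v => dZ (omega X (v.1, u.1)) (omega Y (v.2, u.2))).

Definition ecc_out (z0 : Z) X (x : borel X) : \bar R :=
  'N[mu X]_p[(fun x' => dZ (omega X (x, x')) z0)].

Definition ecc_in (z0 : Z) X (x : borel X) : \bar R :=
  'N[mu X]_p[(fun x' => dZ (omega X (x', x)) z0)].

Definition law_out X (x : borel X) : probability (borel Z) R :=
  distribution (mu X) (lsection (omega X) x).

Definition law_in X (x : borel X) : probability (borel Z) R :=
  distribution (mu X) (rsection (omega X) x).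

Definition law X : probability (borel Z) R :=
  distribution (mu X \x mu X) (omega X).

Lemma measurable_ecc_out (z0 : Z) X : measurable_fun setT (ecc_out z0 X).
Proof.
apply: (@measurable_Lnorm_lsection _ _ _ _ _ _ _ (fun u => dZ (omega X u) z0)).
by apply: (measurableT_comp (measurable_mdist z0)); exact: measurable_funPT.
Qed.

Lemma measurable_ecc_in (z0 : Z) X : measurable_fun setT (ecc_in z0 X).
Proof.
apply: (@measurable_Lnorm_lsection _ _ _ _ _ _ _
  (fun u => dZ (omega X (u.2, u.1)) z0)).
apply: (measurableT_comp (measurable_mdist z0)).
apply: measurableT_comp; first exact: measurable_funPT.
exact: measurable_fun_pair.
Qed.

(* The eccentricities are almost everywhere finite, so that replacing the
   value +oo by 0 with [fine] does not change the pushforwards. *)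
Definition fine_ecc_out (z0 : Z) X : borel X -> borel R^o :=
  fine \o ecc_out z0 X.

Definition fine_ecc_in (z0 : Z) X : borel X -> borel R^o :=
  fine \o ecc_in z0 X.

Let measurable_fine_ecc_out z0 X : measurable_fun setT (fine_ecc_out z0 X).
Proof.
apply: measurable_borel_real.
by apply: measurableT_comp => //; exact: measurable_ecc_out.
Qed.

HB.instance Definition _ z0 X := isMeasurableFun.Build _ _ _ _
  (fine_ecc_out z0 X) (measurable_fine_ecc_out z0 X).

Let measurable_fine_ecc_in z0 X : measurable_fun setT (fine_ecc_in z0 X).
Proof.
apply: measurable_borel_real.
by apply: measurableT_comp => //; exact: measurable_ecc_in.
Qed.

HB.instance Definition _ z0 X := isMeasurableFun.Build _ _ _ _
  (fine_ecc_in z0 X) (measurable_fine_ecc_in z0 X).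

Definition ecc_law_out (z0 : Z) X : probability (borel R^o) R :=
  distribution (mu X) (fine_ecc_out z0 X).

Definition ecc_law_in (z0 : Z) X : probability (borel R^o) R :=
  distribution (mu X) (fine_ecc_in z0 X).

End invariants.

(* Main.v *)
From HB Require Import structures.
Require Import Defs.
From mathcomp Require Import all_boot all_order all_algebra.
From mathcomp Require Import all_classical all_reals all_analysis.
From mathcomp Require Import measurable_realfun ess_sup_inf lra.

Set Implicit Arguments.
Unset Strict Implicit.
Unset Printing Implicit Defensive.

Import Order.TTheory GRing.Theory Num.Theory.
Import numFieldNormedType.Exports.

Local Open Scope classical_set_scope.
Local Open Scope ring_scope.
Local Open Scope ereal_scope.

(** Write d for the distance of Z and call a map measure preserving from m to n
    when it pushes m forward to n.

    The engine is the equality, for measurable f : T1 -> S and g : T2 -> S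
    into a separable metric space, between the infimum over couplings of m1
    and m2 of the Lp-norm of d(f x, g y) and the Wasserstein distance of the
    image measures ([inf_coupling_Wasserstein]).  Pushing a coupling forward
    along (f, g) gives one inequality.  For the other, a coupling gamma of the
    images has to be lifted to T1 * T2, up to a small error.  A dense
    sequence yields, for e > 0, a measurable k : S -> nat such that x is within e
    of the point with index k x.  The law of (k, k) under gamma is a coupling
    of two measures on nat, hence absolutely continuous with respect to their
    product ([discrete_coupling_dominated]); if H is its density, then
    H(k (f x), k (g y)) is the density, with respect to m1 \x m2, of a
    coupling pi of m1 and m2 under which (k (f x), k (g y)) has the same law as
    (k, k) under gamma ([coupling_lift]).  Replacing points by their
    approximations costs 2e for each of pi and gamma.

    This equality, applied to the sections of the network functions, to the
    network functions themselves and to the eccentricities, gives the three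
    identities of the theorem.  The inequalities come from three facts.
    - Tonelli for Lp-norms ([Lnorm_fubini]): the norm over pi \x pi is the
      pi-norm of the norms of the sections, and each of these bounds the
      infimum defining the pairwise eccentricity.  It also identifies the size
      with the Lp-norm of the eccentricity.
    - Minkowski: subtracting the eccentricities relative to z0, or the sizes,
      is controlled by the norm of the distance under a common coupling.
    - If pi couples the two measures, the image of pi \x pi under
      (x, y, x', y') |-> ((x, x'), (y, y')) couples their squares.
    Integrals of nonnegative functions are lower integrals, defined and monotone
    without measurability.  The pairwise eccentricity enters only through this
    monotonicity, between measurable functions below and above it.  The
    eccentricities relative to z0 are +oo at most on a null set, whose inverse
    image in the product is null for every coupling.

    The incoming chain is the outgoing one for the functions with swapped
    arguments; the sizes and the Gromov-Wasserstein cost are unchanged by the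
    swap. *)

(** * Lp-norms with respect to a probability *)

Lemma measurable_preimage d d' (T : measurableType d) (T' : measurableType d')
    (f : T -> T') A :
  measurable_fun setT f -> measurable A -> measurable (f @^-1` A).
Proof. by move=> mf mA; rewrite -[X in measurable X]setTI; exact: mf. Qed.

Lemma measurable_abse_poweR d (T : measurableType d) (R : realType) (r : R)
    (f : T -> \bar R) :
  measurable_fun setT f -> measurable_fun setT (fun x => `|f x| `^ r).
Proof.
move=> mf; apply: (measurableT_comp (measurable_poweR _)).
exact: measurableT_comp.
Qed.

Section Lnorm_probability.
Context {d : measure_display} {T : measurableType d} {R : realType}.
Variable P : probability T R.
Implicit Types (f g : T -> \bar R) (p : \bar R).

Lemma ess_sup_abse_LnormE f : 'N[P]_+oo[f] = ess_sup P (abse \o f).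
Proof. by rewrite unlock /= probability_setT lte01. Qed.

(** The integral of a nonnegative function is a supremum over simple functions
    below it, which makes it monotone on arbitrary functions. *)
Lemma le_ge0_integral (m : {measure set T -> \bar R}) f g :
  (forall x, 0 <= f x) -> (forall x, f x <= g x) ->
  \int[m]_x f x <= \int[m]_x g x.
Proof.
move=> f0 fg; rewrite !ge0_integralTE//; last first.
  by move=> x; exact: le_trans (fg x).
apply: ereal_sup_le => _ [h /= hf <-]; exists h => //= x.
exact: le_trans (fg x).
Qed.

Lemma le_Lnorm p f g : 1 <= p -> (forall x, `|f x| <= `|g x|) ->
  'N[P]_p[f] <= 'N[P]_p[g].
Proof.
case: p => // [r r1|_] fg; last first.
  by rewrite !ess_sup_abse_LnormE; apply: le_ess_sup; exact: nearW.
have r0 : (0 <= r)%R by rewrite -lee_fin (le_trans _ r1).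
rewrite unlock; apply: gt0_ler_poweR; rewrite ?invr_ge0// ?in_itv/= ?leey ?andbT.
- by apply: integral_ge0 => x _; exact: poweR_ge0.
- by apply: integral_ge0 => x _; exact: poweR_ge0.
apply: le_ge0_integral => x; first exact: poweR_ge0.
by apply: gt0_ler_poweR; rewrite // in_itv/= leey andbT.
Qed.

Lemma ae_eq_Lnorm p f g : 1 <= p ->
  measurable_fun setT f -> measurable_fun setT g ->
  (\forall x \ae P, f x = g x) -> 'N[P]_p[f] = 'N[P]_p[g].
Proof.
case: p => // [r r1|_] mf mg fg; last first.
  rewrite !ess_sup_abse_LnormE; apply: eq_ess_sup.
  by apply: filterS fg => x /= ->.
rewrite unlock; congr (_ `^ _); apply: ge0_ae_eq_integral => //.
- exact: measurable_abse_poweR.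
- exact: measurable_abse_poweR.
- by move=> x _; exact: poweR_ge0.
- by move=> x _; exact: poweR_ge0.
- by apply: filterS fg => x /= ->.
Qed.

Lemma Lnorm_lty_ae_fin_num p f : 1 <= p -> measurable_fun setT f ->
  'N[P]_p[f] < +oo -> \forall x \ae P, f x \is a fin_num.
Proof.
case: p => // [r r1|_] mf; last first.
  rewrite ess_sup_abse_LnormE => foo.
  apply: filterS (ess_sup_ge P (abse \o f)) => x /= fx.
  by rewrite fin_num_abs (le_lt_trans fx).
have r0 : r != 0%R by rewrite gt_eqF// -lte_fin (lt_le_trans _ r1).
rewrite unlock => /lty_poweRy; rewrite invr_eq0 => /(_ r0) foo.
have : P.-integrable setT (fun x => `|f x| `^ r).
  apply/integrableP; split.
    exact: measurable_abse_poweR.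
  by under eq_integral do rewrite gee0_abs ?poweR_ge0//.
move=> /(integrable_ae measurableT); apply: filterS => x /(_ I).
rewrite fin_num_abs gee0_abs ?poweR_ge0// => /(lty_poweRy r0).
by rewrite fin_num_abs.
Qed.

Lemma Lnorm_cst p (c : \bar R) : 1 <= p -> 'N[P]_p[cst c] = `|c|.
Proof.
case: p => // [r r1|_]; last first.
  rewrite ess_sup_abse_LnormE (_ : abse \o cst c = cst `|c|)//.
  by rewrite ess_sup_cst// [ltRHS]probability_setT.
have r0 : r != 0%R by rewrite gt_eqF// -lte_fin (lt_le_trans _ r1).
rewrite unlock /= integral_cst// [X in _ * X]probability_setT mule1 -poweRrM divff//.
by rewrite poweRe1.
Qed.

(** Minkowski's inequality in the form of a pointwise bound, which is how the
    triangle inequality of a metric produces it. *)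
Lemma Lnorm_triangle p (f g h : T -> R) : 1 <= p ->
  measurable_fun setT g -> measurable_fun setT h ->
  (forall x, `|f x| <= `|g x| + `|h x|)%R ->
  'N[P]_p[EFin \o f] <= 'N[P]_p[EFin \o g] + 'N[P]_p[EFin \o h].
Proof.
move=> p1 mg mh fgh.
rewrite -(Lnorm_abse _ (EFin \o g)) -(Lnorm_abse _ (EFin \o h)).
pose g' := (Num.norm \o g)%R; pose h' := (Num.norm \o h)%R.
apply: (@le_trans _ _ 'N[P]_p[EFin \o (g' \+ h')%R]).
  apply: le_Lnorm => // x /=; rewrite lee_fin (le_trans (fgh x))//.
  exact: ler_norm.
by apply: eminkowski => //; exact: measurableT_comp.
Qed.

End Lnorm_probability.

(** * Measure-preserving maps *)

Section pushes.
Context {d d' : measure_display} {T : measurableType d} {T' : measurableType d'}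
  {R : realType}.
Implicit Types (m : probability T R) (n : probability T' R).

(** A probability is a function on all sets, so that the equality with the image
    measure is only asked on measurable sets; the marginal conditions of a
    coupling are instances of this, for the two projections. *)
Definition pushes m (phi : T -> T') n : Prop :=
  forall A, measurable A -> m (phi @^-1` A) = n A.

Lemma ex_pushes m (phi : T -> T') :
  measurable_fun setT phi -> exists n, pushes m phi n.
Proof.
move=> mphi.
pose X : {mfun T >-> T'} := HB.pack phi (isMeasurableFun.Build _ _ _ _ phi mphi).
by exists (distribution m X).
Qed.

Lemma pushes_ae m (phi : T -> T') n (Q : T' -> Prop) :
  measurable_fun setT phi -> pushes m phi n ->
  (\forall y \ae n, Q y) -> \forall x \ae m, Q (phi x).
Proof.
move=> mphi push [N [mN N0 QN]]; exists (phi @^-1` N); split.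
- exact: measurable_preimage.
- by rewrite push.
- by move=> x /= nQ; exact: QN.
Qed.

Lemma ge0_integral_pushes m (phi : T -> T') n (D : set T') (f : T' -> \bar R) :
  measurable_fun setT phi -> pushes m phi n -> measurable D ->
  measurable_fun setT f -> (forall y, 0 <= f y) ->
  \int[n]_(y in D) f y = \int[m]_(x in phi @^-1` D) f (phi x).
Proof.
move=> mphi push mD mf f0.
pose phi' : {mfun T >-> T'} := HB.pack phi (isMeasurableFun.Build _ _ _ _ phi mphi).
rewrite (eq_measure_integral (distribution m phi')).
  by rewrite ge0_integral_pushforward//; exact: measurable_funTS.
by move=> A mA _; rewrite /= /distribution /pushforward /= push.
Qed.

Lemma Lnorm_pushes m (phi : T -> T') n p (f : T' -> \bar R) : 1 <= p ->
  measurable_fun setT phi -> pushes m phi n -> measurable_fun setT f ->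
  'N[n]_p[f] = 'N[m]_p[(fun x => f (phi x))].
Proof.
case: p => // [r r1|_] mphi push mf; last first.
  rewrite !ess_sup_abse_LnormE; apply/eqP; rewrite eq_le; apply/andP; split.
    have mf' : measurable_fun setT (abse \o f) by exact: measurableT_comp.
    apply/ess_supP; apply/(ae_le_measureP _ _ mf').
    set B := (_ @^-1` _); have mB : measurable B.
      by rewrite -[B]setTI; apply: mf' => //; exact: emeasurable_itv.
    rewrite -[LHS]push//; apply/(ae_le_measureP m _
      (f := (fun x => `|f (phi x)|))).
      exact: (measurableT_comp mf').
    exact: ess_sup_ge.
  apply/ess_supP.
  apply: (pushes_ae mphi push (Q := fun y => `|f y| <= _)).
  exact: ess_sup_ge.
rewrite unlock; congr (_ `^ _).
rewrite (ge0_integral_pushes mphi push measurableT (f := fun y => `|f y| `^ r))//.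
- exact: measurable_abse_poweR.
- by move=> y; exact: poweR_ge0.
Qed.

End pushes.

(** * Iterated Lp-norms *)

Section Lnorm_fubini.
Context {d1 d2 : measure_display} {T1 : measurableType d1}
  {T2 : measurableType d2} {R : realType}.
Variables (m1 : probability T1 R) (m2 : probability T2 R).

(** For finite p this is Tonelli's theorem for the p-th power.  For p = +oo,
    both sides have the same upper bounds y: the set where the function exceeds y
    is null for the product exactly when almost all its sections are null. *)
Lemma Lnorm_fubini p (f : T1 * T2 -> \bar R) : 1 <= p ->
  measurable_fun setT f ->
  'N[(m1 \x m2)]_p[f] = 'N[m1]_p[(fun x => 'N[m2]_p[(fun y => f (x, y))])].
Proof.
case: p => // [r r1|_] mf; last first.
  rewrite !ess_sup_abse_LnormE.
  rewrite (eq_ess_sup (g := fun x => ess_sup m2 (fun y => `|f (x, y)|))); last first.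
    by apply: nearW => x; rewrite /= gee0_abs ?Lnorm_ge0// ess_sup_abse_LnormE.
  have mf' : measurable_fun setT (abse \o f) by exact: measurableT_comp.
  have eqv y : (ess_sup (m1 \x m2)%E (abse \o f) <= y) =
      (ess_sup m1 (fun x => ess_sup m2 (fun y => `|f (x, y)|)) <= y).
    pose B := (abse \o f) @^-1` `]y, +oo[.
    have mB : measurable B.
      by rewrite -[B]setTI; apply: mf' => //; exact: emeasurable_itv.
    have secE x : (ess_sup m2 (fun y => `|f (x, y)|) <= y) <-> m2 (xsection B x) = 0.
      apply: (iff_trans (iff_sym (rwP ess_supP))).
      apply: (iff_trans (ae_le_measureP m2 _ _)).
        exact: (measurableT_comp mf').
      by rewrite (_ : xsection B x = (fun y => `|f (x, y)|) @^-1` `]y, +oo[)//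
        xsectionE.
    have BE : (m1 \x m2) B = \int[m1]_x `|m2 (xsection B x)|.
      by apply: eq_integral => x _; rewrite gee0_abs.
    have mB2 := measurable_fun_xsection m2 mB.
    apply/ess_supP/ess_supP => [/(ae_le_measureP _ _ mf') B0|h].
      have /(ae_eq_integral_abs _ measurableT mB2) := etrans (esym BE) B0.
      by apply: filterS => x /(_ I)/= /secE.
    apply/(ae_le_measureP _ _ mf').
    apply: etrans BE _; apply/(ae_eq_integral_abs _ measurableT mB2).
    by apply: filterS h => x /secE.
  by apply/eqP; rewrite eq_le eqv lexx -eqv lexx.
have r0 : r != 0%R by rewrite gt_eqF// -lte_fin (lt_le_trans _ r1).
rewrite unlock /=; congr (_ `^ _).
rewrite fubini_tonelli1//=; last 2 first.
- exact: measurable_abse_poweR.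
- by move=> x; exact: poweR_ge0.
apply: eq_integral => x _; rewrite gee0_abs ?poweR_ge0//.
rewrite -poweRrM mulVf// poweRe1//.
by apply: integral_ge0 => y _; exact: poweR_ge0.
Qed.
End Lnorm_fubini.

(** * Lifting a coupling along measure-preserving maps *)

Lemma density_probability d (T : measurableType d) (R : realType)
    (m : {measure set T -> \bar R}) (h : T -> \bar R) :
  measurable_fun setT h -> (forall x, 0 <= h x) -> \int[m]_x h x = 1 ->
  exists P : probability T R, forall A, P A = \int[m]_(x in A) h x.
Proof.
move=> mh h0 h1; pose nu A := \int[m]_(x in A) h x.
have nu0 : nu set0 = 0 by rewrite /nu integral_set0.
have nu_ge0 A : 0 <= nu A by exact: integral_ge0.
have nuS : semi_sigma_additive nu by exact: semi_sigma_additive_nng_induced.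
pose M := HB.pack_for (Measure.type T R) nu
  (isMeasure.Build _ _ _ nu nu0 nu_ge0 nuS).
have M1 : M setT = 1 by [].
pose P := HB.pack_for (probability T R) (Measure.sort M)
  (Measure_isProbability.Build _ _ _ M M1).
by exists P.
Qed.

Section product_domain.
Context {d1 d2 : measure_display} {T1 : measurableType d1}
  {T2 : measurableType d2} {R : realType}.
Variables (m1 : probability T1 R) (m2 : probability T2 R).
Variable F : T1 * T2 -> \bar R.
Hypotheses (mF : measurable_fun setT F) (F0 : forall u, 0 <= F u).

Lemma integral_fst_preimage A : measurable A ->
  \int[m1 \x m2]_(u in fst @^-1` A) F u =
  \int[m1]_(x in A) \int[m2]_y F (x, y).
Proof.
move=> mA; rewrite integral_mkcond [RHS]integral_mkcond fubini_tonelli1.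
- apply: eq_integral => x _; rewrite /fubini_F /patch; case: ifPn => xA.
    by apply: eq_integral => y _; rewrite ifT//; move: xA; rewrite !inE.
  rewrite integral0_eq// => y _.
  by rewrite ifF//; apply/negbTE; apply: contra xA; rewrite !inE.
- apply/(measurable_restrictT _ _).1; last exact: measurable_funTS.
  exact: (measurable_preimage measurable_fst).
- by move=> u; rewrite /patch; case: ifP.
Qed.

Lemma integral_snd_preimage B : measurable B ->
  \int[m1 \x m2]_(u in snd @^-1` B) F u =
  \int[m2]_(y in B) \int[m1]_x F (x, y).
Proof.
move=> mB; rewrite integral_mkcond [RHS]integral_mkcond fubini_tonelli2.
- apply: eq_integral => y _; rewrite /fubini_G /patch; case: ifPn => yB.
    by apply: eq_integral => x _; rewrite ifT//; move: yB; rewrite !inE.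
  rewrite integral0_eq// => x _.
  by rewrite ifF//; apply/negbTE; apply: contra yB; rewrite !inE.
- apply/(measurable_restrictT _ _).1; last exact: measurable_funTS.
  exact: (measurable_preimage measurable_snd).
- by move=> u; rewrite /patch; case: ifP.
Qed.

End product_domain.

(** The image measure and the product agree on rectangles, which determine a
    product measure. *)
Lemma pushes_prod d1 d2 d1' d2' (T1 : measurableType d1)
    (T2 : measurableType d2) (S1 : measurableType d1') (S2 : measurableType d2')
    (R : realType) (m1 : probability T1 R) (m2 : probability T2 R)
    (l1 : probability S1 R) (l2 : probability S2 R) k1 k2 :
  measurable_fun setT k1 -> measurable_fun setT k2 ->
  pushes m1 k1 l1 -> pushes m2 k2 l2 ->
  pushes (m1 \x m2) (fun u => (k1 u.1, k2 u.2)) (l1 \x l2).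
Proof.
move=> mk1 mk2 pk1 pk2 A mA; pose k (u : T1 * T2) := (k1 u.1, k2 u.2).
have mk : measurable_fun setT k.
  by apply: measurable_fun_pair; exact: measurableT_comp.
pose k' : {mfun _ >-> _} := HB.pack k (isMeasurableFun.Build _ _ _ _ k mk).
apply/esym/(product_measure_unique (m' := distribution (m1 \x m2) k')) => //.
move=> B C mB mC; rewrite /= /distribution /pushforward /=.
rewrite (_ : k @^-1` (B `*` C) = (k1 @^-1` B) `*` (k2 @^-1` C))//.
rewrite product_measure1E//; first by congr (_ * _); [exact: pk1|exact: pk2].
- exact: (measurable_preimage mk1).
- exact: (measurable_preimage mk2).
Qed.

(** This computes the marginals of a lifted coupling: Phi is the partial
    integral of its density, and is 1 almost everywhere since its integrals over all
    measurable sets are the measures of these sets. *)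
Lemma integral_pushes_density1 d d' (T : measurableType d)
    (S : measurableType d') (R : realType) (m : probability T R)
    (l : probability S R) (k : T -> S) (Phi : S -> \bar R) :
  measurable_fun setT k -> pushes m k l -> measurable_fun setT Phi ->
  (forall i, 0 <= Phi i) ->
  (forall B, measurable B -> \int[l]_(i in B) Phi i = l B) ->
  forall A, measurable A -> \int[m]_(x in A) Phi (k x) = m A.
Proof.
move=> mk push mPhi Phi0 Phi1 A mA.
have : ae_eq l setT Phi (cst 1).
  apply: integral_ae_eq => //.
    apply/integrableP; split => //.
    under eq_integral do rewrite gee0_abs//.
    by rewrite Phi1// [X in X < _]probability_setT ltry.
  by move=> B _ mB; rewrite Phi1// integral_cst// mul1e.
move=> Phiae.
have aePhi : \forall x \ae m, Phi (k x) = 1.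
  apply: (pushes_ae mk push (Q := fun i => Phi i = 1)).
  by apply: filterS Phiae => i /(_ I).
rewrite (ge0_ae_eq_integral (g := cst 1))//.
- by rewrite integral_cst// mul1e.
- by apply: measurable_funTS; exact: measurableT_comp.
- by apply: filterS aePhi => x + _.
Qed.

Section gluing.
Context {d1 d2 d1' d2' : measure_display} {T1 : measurableType d1}
  {T2 : measurableType d2} {S1 : measurableType d1'} {S2 : measurableType d2'}
  {R : realType}.
Variables (m1 : probability T1 R) (m2 : probability T2 R).
Variables (l1 : probability S1 R) (l2 : probability S2 R).

(** The density H of l with respect to l1 \x l2, composed with (k1, k2), is a
    density with respect to m1 \x m2, because (k1, k2) maps m1 \x m2 to
    l1 \x l2.  Its partial integrals are those of H composed with k1 or k2,
    and the latter are 1 almost everywhere as l has marginals l1 and l2. *)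
Lemma coupling_lift (k1 : T1 -> S1) (k2 : T2 -> S2)
    (l : probability (S1 * S2)%type R) :
  measurable_fun setT k1 -> measurable_fun setT k2 ->
  pushes m1 k1 l1 -> pushes m2 k2 l2 ->
  coupling l1 l2 l ->
  (forall C, measurable C -> (l1 \x l2) C = 0 -> l C = 0) ->
  exists2 pi, coupling m1 m2 pi & pushes pi (fun u => (k1 u.1, k2 u.2)) l.
Proof.
move=> mk1 mk2 pk1 pk2 [ll1 ll2] dom.
have [|H [H0 iH HE]] := @radon_nikodym_finite _ (S1 * S2)%type R
  (l1 \x l2 : probability (S1 * S2)%type R) l.
  by move=> N N0 A mA AN; apply: dom => //; exact: N0.
have mH : measurable_fun setT H by exact: measurable_int iH.
pose k (u : T1 * T2) := (k1 u.1, k2 u.2).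
have mk : measurable_fun setT k.
  by apply: measurable_fun_pair; exact: measurableT_comp.
have pk : pushes (m1 \x m2) k (l1 \x l2) by exact: pushes_prod.
have hE C : measurable C -> \int[m1 \x m2]_(u in k @^-1` C) H (k u) = l C.
  by move=> mC; rewrite -(ge0_integral_pushes mk pk mC mH H0) -HE.
have [|||pi piE] := @density_probability _ _ _ (m1 \x m2) (H \o k).
- exact: measurableT_comp.
- by move=> u; exact: H0.
- exact: (etrans (hE setT measurableT) (probability_setT _)).
have mHk : measurable_fun setT (H \o k) by exact: measurableT_comp.
have Hk0 u : 0 <= (H \o k) u by exact: H0.
exists pi; last by move=> C mC; rewrite piE hE.
split=> A mA.
  rewrite piE (integral_fst_preimage _ _ mHk Hk0)//.
  apply: (integral_pushes_density1 mk1 pk1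
    (Phi := fun i => \int[m2]_y H (i, k2 y))) => //.
  - apply: (measurable_fun_fubini_tonelli_F (m2 := m2)
      (fun v => H (v.1, k2 v.2))) => //.
    apply: (measurableT_comp mH); apply: measurable_fun_pair => //.
    exact: measurableT_comp.
  - by move=> i; exact: integral_ge0.
  move=> B mB.
  rewrite -ll1// HE; last exact: (measurable_preimage measurable_fst).
  rewrite integral_fst_preimage//; apply: eq_integral => i _.
  rewrite (ge0_integral_pushes mk2 pk2 (f := fun j => H (i, j)))//.
  exact: (measurableT_comp mH (pair1_measurable i)).
rewrite piE (integral_snd_preimage _ _ mHk Hk0)//.
apply: (integral_pushes_density1 mk2 pk2
  (Phi := fun j => \int[m1]_x H (k1 x, j))) => //.
- apply: (measurable_fun_fubini_tonelli_G (m1 := m1)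
    (fun v => H (k1 v.1, v.2))) => //.
  apply: (measurableT_comp mH); apply: measurable_fun_pair => //.
  exact: measurableT_comp.
- by move=> j; exact: integral_ge0.
move=> B mB.
rewrite -ll2// HE; last exact: (measurable_preimage measurable_snd).
rewrite integral_snd_preimage//; apply: eq_integral => j _.
rewrite (ge0_integral_pushes mk1 pk1 (f := fun i => H (i, j)))//.
exact: (measurableT_comp mH (pair2_measurable j)).
Qed.
End gluing.

(** * Countable approximation of a separable metric space *)

(** A point (i, j) which is null for the product has l1 i = 0 or l2 j = 0, so it
    lies on a null line for l, and there are countably many points. *)
Lemma discrete_coupling_dominated (R : realType)
    (l1 l2 : probability nat R) (l : probability (nat * nat)%type R) :
  coupling l1 l2 l ->
  forall C, measurable C -> (l1 \x l2) C = 0 -> l C = 0.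
Proof.
move=> [ll1 ll2] C mC C0; apply/negligibleP => //.
pose F i j := C `&` ([set i] `*` [set j]).
have -> : C = \bigcup_i \bigcup_j F i j.
  apply/seteqP; split=> [[i j] Cij|u [i _ [j _ []//]]].
  by exists i => //; exists j.
apply: negligible_bigcup => i; apply: negligible_bigcup => j.
have mij : measurable ([set i] `*` [set j]) by exact: measurableX.
have mF : measurable (F i j) by exact: measurableI.
apply/(negligibleP l mF).
have [Cij|nCij] := pselect (C (i, j)); last first.
  rewrite (_ : F i j = set0) ?measure0//.
  by apply/seteqP; split=> // -[a b] [Cab [/= ai bj]]; apply: nCij; rewrite -ai -bj.
have : (l1 \x l2) ([set i] `*` [set j]) = 0.
  apply/eqP; rewrite eq_le measure_ge0 andbT -C0 le_measure ?inE//.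
  by move=> [a b] [/= -> ->].
rewrite product_measure1E// => /eqP; rewrite mule_eq0 => /orP[]/eqP l0.
  apply/eqP; rewrite eq_le measure_ge0 andbT -l0 -[leRHS]ll1// le_measure ?inE//.
    exact: (measurable_preimage measurable_fst).
  by move=> [a b] [_ []].
apply/eqP; rewrite eq_le measure_ge0 andbT -l0 -[leRHS]ll2// le_measure ?inE//.
  exact: (measurable_preimage measurable_snd).
by move=> [a b] [_ []].
Qed.

Lemma measurable_fun_to_nat d (T : measurableType d) (f : T -> nat) :
  (forall n, measurable (f @^-1` [set n])) -> measurable_fun setT f.
Proof.
move=> mf _ A _; rewrite setTI.
have -> : f @^-1` A = \bigcup_(n in A) f @^-1` [set n].
  by apply/seteqP; split=> [x Ax|x [n An /= ->]//]; exists (f x).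
exact: bigcup_measurable.
Qed.

Section separable_metric.
Context {R : realType} {S : completeMetricType R}.
Local Notation dist := (@mdist R S).

Lemma separable_dense_seq (s0 : S) : separable S ->
  exists z : nat -> S, forall x (e : R), (0 < e)%R -> exists n, (dist (z n) x < e)%R.
Proof.
move=> [D cD dD].
have [D0|[z]] := pfcard_geP cD.
  have [|x []] := dD setT _ openT; first by exists s0.
  by rewrite D0.
exists z => x e e0.
have [||y [+ Dy]] := dD (ball x e).
- by exists x; exact: ballxx.
- by rewrite openE => y; rewrite ballEmdist => /= xy; apply/nbhs_ballP;
    exists (e - dist x y)%R => /=; rewrite ?subr_gt0// => w;
    rewrite !ballEmdist/= => yw; rewrite (le_lt_trans (metric_triangle x y w))//
      -ltrBrDl.
rewrite ballEmdist/= => xy.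
have [n _ zn] : (z @` setT) y by exact: surj.
by exists n; rewrite zn metric_sym.
Qed.

(** The sigma-algebra on pairs is the product one, so that continuity of the
    distance does not suffice: separability writes the distance as a countable
    infimum of sums of functions of one variable. *)
Lemma measurable_mdist_pair (s0 : S) : separable S ->
  measurable_fun [set: (borel S * borel S)%type]
    (fun u => (dist u.1 u.2)%:E).
Proof.
move=> /(separable_dense_seq s0)[z zP].
rewrite (_ : (fun _ => _) = fun u : borel S * borel S =>
    einfs (fun n => (dist u.1 (z n))%:E + (dist u.2 (z n))%:E) 0%N).
  apply: measurable_fun_einfs => n; apply: emeasurable_funD.
    by apply: (measurableT_comp (measurable_mdist (z n))).
  by apply: (measurableT_comp (measurable_mdist (z n))).
apply/funext => -[x y] /=; apply/eqP; rewrite eq_le; apply/andP; split.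
  apply: le_ereal_inf_tmp => _ [n /= _ <-].
  by rewrite -EFinD lee_fin (metric_sym y) metric_triangle.
apply/lee_addgt0Pr => e e0; have [n zn] := zP x (e / 2)%R (divr_gt0 e0 (ltr0Sn _ 1)).
apply: ge_ereal_inf; exists ((dist x (z n))%:E + (dist y (z n))%:E).
  by exists n.
have := metric_triangle y x (z n).
rewrite -!EFinD lee_fin (metric_sym y x) (metric_sym x (z n)).
lra.
Qed.

(** Taking for k x the first index of a point within e of x makes the level sets
    of k differences of a ball and finitely many others, hence measurable. *)
Lemma countable_quantization (s0 : S) (e : R) : separable S -> (0 < e)%R ->
  exists (z : nat -> S) (k : borel S -> nat), measurable_fun setT k /\
    forall x, (dist (z (k x)) x < e)%R.
Proof.
move=> /(separable_dense_seq s0)[z zP] e0; pose k x := ex_minn (zP x e e0).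
exists z, k; split; last by move=> x; rewrite /k; case: ex_minnP.
pose B n : set (borel S) := [set x | (dist (z n) x < e)%R].
have mB n : measurable (B n).
  rewrite (_ : B n = (fun x => (dist x (z n))%:E) @^-1` `]-oo, e%:E[).
    by apply: (measurable_preimage (measurable_mdist (z n))); exact: emeasurable_itv.
  by apply/seteqP; split=> x; rewrite /B/= in_itv/= lte_fin metric_sym.
apply: measurable_fun_to_nat => n.
rewrite (_ : k @^-1` [set n] = B n `\` \bigcup_(m in [set m | (m < n)%N]) B m).
  by apply: measurableD => //; exact: bigcup_measurable.
apply/seteqP; split=> x /=; rewrite /k; case: ex_minnP => m zm mmin.
  move=> <-; split=> // -[i /= im /mmin]; by rewrite leqNgt im.
move=> [/mmin mn nlt]; apply/eqP; rewrite eqn_leq mn leqNgt.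
by apply/negP => nm; apply: nlt; exists m.
Qed.

End separable_metric.

(** * Couplings of image measures *)

Section coupling_pushforward.
Context {d1 d2 d1' d2' : measure_display} {T1 : measurableType d1}
  {T2 : measurableType d2} {S1 : measurableType d1'} {S2 : measurableType d2'}
  {R : realType}.
Variables (m1 : probability T1 R) (m2 : probability T2 R).
Variables (l1 : probability S1 R) (l2 : probability S2 R).

Lemma coupling_pushes pi l k1 k2 :
  measurable_fun setT k1 -> measurable_fun setT k2 ->
  pushes m1 k1 l1 -> pushes m2 k2 l2 -> coupling m1 m2 pi ->
  pushes pi (fun u => (k1 u.1, k2 u.2)) l -> coupling l1 l2 l.
Proof.
move=> mk1 mk2 pk1 pk2 [pi1 pi2] pk; split=> A mA.
- rewrite -pk; last exact: (measurable_preimage measurable_fst).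
  by rewrite -pk1// -pi1//; exact: measurable_preimage.
- rewrite -pk; last exact: (measurable_preimage measurable_snd).
  by rewrite -pk2// -pi2//; exact: measurable_preimage.
Qed.

End coupling_pushforward.

Section Wasserstein_distribution.
Context {d1 d2 : measure_display} {T1 : measurableType d1}
  {T2 : measurableType d2} {R : realType} {S : completeMetricType R}.
Variables (m1 : probability T1 R) (m2 : probability T2 R).
Variables (f : {mfun T1 >-> borel S}) (g : {mfun T2 >-> borel S}).
Local Notation dist := (@mdist R S).

Let mf : measurable_fun setT f. Proof. exact: measurable_funPT. Qed.
Let mg : measurable_fun setT g. Proof. exact: measurable_funPT. Qed.

Let mfg : measurable_fun setT (fun u : T1 * T2 => (f u.1, g u.2)).
Proof.
apply: measurable_fun_pair.
- exact: (measurableT_comp mf).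
- exact: (measurableT_comp mg).
Qed.

Lemma Wasserstein_distribution_le p (s0 : S) : separable S -> 1 <= p ->
  Wasserstein p (distribution m1 f) (distribution m2 g) <=
  inf_coupling p m1 m2 (fun u => (dist (f u.1) (g u.2))%:E).
Proof.
move=> sepS p1; apply: le_ereal_inf_tmp => _ [pi cpi <-].
have [gam pgam] := ex_pushes pi mfg.
apply: ge_ereal_inf; exists 'N[gam]_p[(fun u => (dist u.1 u.2)%:E)].
  exists gam => //.
  exact: (coupling_pushes (l1 := distribution m1 f) (l2 := distribution m2 g)
    mf mg _ _ cpi pgam).
rewrite (Lnorm_pushes p1 mfg pgam)//; exact: measurable_mdist_pair.
Qed.

Let dist_perturb p d (T : measurableType d) (P : probability T R)
    (x y x' y' : T -> S) (e : R) : 1 <= p -> (0 < e)%R ->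
  measurable_fun setT (fun t => dist (x' t) (y' t)) ->
  (forall t, dist (x' t) (x t) < e)%R -> (forall t, dist (y' t) (y t) < e)%R ->
  'N[P]_p[(fun t => (dist (x t) (y t))%:E)] <=
  'N[P]_p[(fun t => (dist (x' t) (y' t))%:E)] + (e + e)%:E.
Proof.
move=> p1 e0 md xx' yy'.
rewrite -[leRHS](_ : 'N[P]_p[(fun t => (dist (x' t) (y' t))%:E)] +
    'N[P]_p[EFin \o cst (e + e)%R] = _); last first.
  by rewrite (Lnorm_cst P (e + e)%:E p1) gee0_abs// lee_fin addr_ge0// ltW.
apply: (Lnorm_triangle P (f := fun t => dist (x t) (y t))
  (h := cst (e + e)%R) p1 md) => // t.
rewrite (ger0_norm (mdist_ge0 _ _)) (ger0_norm (mdist_ge0 _ _)).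
rewrite ger0_norm ?addr_ge0 ?ltW//=.
have := metric_triangle (x t) (x' t) (y t).
have := metric_triangle (x' t) (y' t) (y t).
rewrite (metric_sym (x t) (x' t)); move: (xx' t) (yy' t); lra.
Qed.

(** A coupling gamma of the images is quantized to a coupling of measures on
    nat, which is lifted to a coupling pi of m1 and m2; the two quantizations
    compare pi and gamma through their common law on nat * nat. *)
Lemma Wasserstein_distribution_ge p (s0 : S) : separable S -> 1 <= p ->
  inf_coupling p m1 m2 (fun u => (dist (f u.1) (g u.2))%:E) <=
  Wasserstein p (distribution m1 f) (distribution m2 g).
Proof.
move=> sepS p1; apply: le_ereal_inf_tmp => _ [gam cgam <-].
apply/lee_addgt0Pr => e e0.
have e40 : (0 < e / 4)%R by exact: divr_gt0.
have [z [k [mk kz]]] := countable_quantization s0 sepS e40.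
have mS := measurable_mdist_pair s0 sepS.
have [l1 pl1] := ex_pushes (distribution m1 f) mk.
have [l2 pl2] := ex_pushes (distribution m2 g) mk.
have mkk : measurable_fun setT (fun u : borel S * borel S => (k u.1, k u.2)).
  by apply: measurable_fun_pair; exact: (measurableT_comp mk).
have [l pl] := ex_pushes gam mkk.
have cl : coupling l1 l2 l by exact: (coupling_pushes mk mk pl1 pl2 cgam pl).
have mkf := measurableT_comp mk mf.
have mkg := measurableT_comp mk mg.
have pkf : pushes m1 (k \o f) l1 by move=> A mA; rewrite -pl1.
have pkg : pushes m2 (k \o g) l2 by move=> A mA; rewrite -pl2.
have [pi cpi ppi] := coupling_lift mkf mkg pkf pkg cl (discrete_coupling_dominated cl).
apply: ge_ereal_inf; eexists; first by exists pi.
have mz : measurable_fun setT (z : nat -> borel S) by [].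
have mzz : measurable_fun setT
    (fun n : nat * nat => (z n.1, z n.2) : borel S * borel S).
  by apply: measurable_fun_pair; exact: (measurableT_comp mz).
have md : measurable_fun setT (fun n : nat * nat => (dist (z n.1) (z n.2))%:E).
  exact: (measurableT_comp mS mzz).
have mfgk := measurable_fun_pair (measurableT_comp mkf measurable_fst)
  (measurableT_comp mkg measurable_snd).
(* Half of the error is spent in passing from pi to the law on nat * nat, and
   half in passing from this law to gamma. *)
have -> : e = ((e / 4 + e / 4) + (e / 4 + e / 4))%R by lra.
rewrite EFinD addeA.
apply: le_trans (leeD2r _ _).
  apply: (dist_perturb pi p1 e40 (x' := fun u => z (k (f u.1)))
    (y' := fun u => z (k (g u.2)))) => //.
  by apply/measurable_EFinP; exact: (measurableT_comp md mfgk).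
rewrite -(Lnorm_pushes p1 mfgk ppi md) (Lnorm_pushes p1 mkk pl md).
apply: (dist_perturb gam p1 e40 (x := fun u => z (k u.1))
    (y := fun u => z (k u.2))) => //.
- by apply/measurable_EFinP.
- by move=> t; rewrite metric_sym.
- by move=> t; rewrite metric_sym.
Qed.

Lemma inf_coupling_Wasserstein p (s0 : S) : separable S -> 1 <= p ->
  inf_coupling p m1 m2 (fun u => (dist (f u.1) (g u.2))%:E) =
  Wasserstein p (distribution m1 f) (distribution m2 g).
Proof.
by move=> sepS p1; apply/eqP; rewrite eq_le (Wasserstein_distribution_le s0)//
  (Wasserstein_distribution_ge s0).
Qed.

End Wasserstein_distribution.

(** * Differences of eccentricities *)

Lemma le_inf_coupling d1 d2 (T1 : measurableType d1) (T2 : measurableType d2)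
    (R : realType) p (m1 : probability T1 R) (m2 : probability T2 R)
    (F G : T1 * T2 -> \bar R) :
  (forall pi, coupling m1 m2 pi -> 'N[pi]_p[F] <= 'N[pi]_p[G]) ->
  inf_coupling p m1 m2 F <= inf_coupling p m1 m2 G.
Proof.
move=> FG; apply: le_ereal_inf_tmp => _ [pi cpi <-].
by apply: ge_ereal_inf; exists 'N[pi]_p[F]; [exists pi|exact: FG].
Qed.

Lemma inf_coupling_ge0 d1 d2 (T1 : measurableType d1) (T2 : measurableType d2)
    (R : realType) p (m1 : probability T1 R) (m2 : probability T2 R)
    (F : T1 * T2 -> \bar R) : 0 <= inf_coupling p m1 m2 F.
Proof. by apply: le_ereal_inf_tmp => _ [pi _ <-]; exact: Lnorm_ge0. Qed.

(** If D is finite then a and b are both finite or both +oo; in the second case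
    their real parts are 0 by convention. *)
Lemma fine_dist_le (R : realType) (a b D : \bar R) : 0 <= a -> 0 <= b -> 0 <= D ->
  a <= D + b -> b <= D + a -> (`|fine a - fine b|)%:E <= D.
Proof.
case: D => [D|_ _ _|]//; last by rewrite leey.
case: a => [a| |]//; case: b => [b| |]//= _ _ D0; last first.
  by rewrite subr0 normr0.
rewrite -!EFinD !lee_fin => aDb bDa.
by rewrite ler_norml; apply/andP; split; lra.
Qed.

Section eccentricity.
Context {d1 d2 : measure_display} {T1 : measurableType d1}
  {T2 : measurableType d2} {R : realType}.
Variables (m1 : probability T1 R) (m2 : probability T2 R).
Variables (a : T1 -> \bar R) (b : T2 -> \bar R) (p : \bar R).
Hypotheses (p1 : 1 <= p) (ma : measurable_fun setT a) (mb : measurable_fun setT b).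
Hypotheses (aoo : 'N[m1]_p[a] < +oo) (boo : 'N[m2]_p[b] < +oo).

(** The functions a and b are finite almost everywhere, and a coupling sees only
    their values outside null sets.  The right-hand side is the distance of
    fine (a u.1) and fine (b u.2) on the real line as it unfolds. *)
Lemma Lnorm_fineB pi : coupling m1 m2 pi ->
  'N[pi]_p[(fun u => a u.1 - b u.2)] =
  'N[pi]_p[(fun u => (`|fine (b u.2) - fine (a u.1)|)%:E)].
Proof.
move=> [pi1 pi2].
rewrite -(Lnorm_abse _ (fun u : T1 * T2 => a u.1 - b u.2)).
have mau : measurable_fun setT (fun u : T1 * T2 => a u.1).
  exact: (measurableT_comp ma).
have mbu : measurable_fun setT (fun u : T1 * T2 => b u.2).
  exact: (measurableT_comp mb).
apply: ae_eq_Lnorm => //.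
- by apply: measurableT_comp => //; exact: emeasurable_funB.
- apply/measurable_EFinP; apply: measurableT_comp => //.
  by apply: measurable_funB; exact: measurableT_comp.
have := pushes_ae measurable_snd pi2 (Lnorm_lty_ae_fin_num p1 mb boo).
have := pushes_ae measurable_fst pi1 (Lnorm_lty_ae_fin_num p1 ma aoo).
apply: filterS2 => -[x y] /= ax byy.
by rewrite -{1}(fineK ax) -{1}(fineK byy) -EFinB abse_EFin distrC.
Qed.

Lemma Lnorm_fine d (T : measurableType d) (m : probability T R) (c : T -> \bar R) :
  measurable_fun setT c -> 'N[m]_p[c] < +oo ->
  'N[m]_p[EFin \o (fine \o c)] = 'N[m]_p[c].
Proof.
move=> mc coo; apply: ae_eq_Lnorm => //.
  by apply/measurable_EFinP; exact: measurableT_comp.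
by apply: filterS (Lnorm_lty_ae_fin_num p1 mc coo) => x cx; rewrite /= fineK.
Qed.

(** Both norms can be computed under any coupling, and Minkowski's inequality
    applies there. *)
Lemma dist_Lnorm_le_inf_coupling :
  `|'N[m1]_p[a] - 'N[m2]_p[b]| <=
  inf_coupling p m1 m2 (fun u => (`|fine (b u.2) - fine (a u.1)|)%:E).
Proof.
have afin : 'N[m1]_p[a] \is a fin_num by rewrite ge0_fin_numE ?Lnorm_ge0.
have bfin : 'N[m2]_p[b] \is a fin_num by rewrite ge0_fin_numE ?Lnorm_ge0.
apply: le_ereal_inf_tmp => _ [pi [pi1 pi2] <-].
rewrite -(fineK afin) -(fineK bfin) -EFinB abse_EFin.
have mfa := measurableT_comp (@fine_measurable R _ measurableT) ma.
have mfb := measurableT_comp (@fine_measurable R _ measurableT) mb.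
have mau : measurable_fun setT (fun u : T1 * T2 => fine (a u.1)).
  exact: (measurableT_comp mfa).
have mbu : measurable_fun setT (fun u : T1 * T2 => fine (b u.2)).
  exact: (measurableT_comp mfb).
have mabu : measurable_fun setT (fun u : T1 * T2 => `|fine (b u.2) - fine (a u.1)|%R).
  by apply: measurableT_comp => //; exact: measurable_funB.
have aE : 'N[m1]_p[a] = 'N[pi]_p[EFin \o (fun u => fine (a u.1))].
  rewrite -(Lnorm_fine ma aoo) (Lnorm_pushes p1 measurable_fst pi1)//.
  exact/measurable_EFinP.
have bE : 'N[m2]_p[b] = 'N[pi]_p[EFin \o (fun u => fine (b u.2))].
  rewrite -(Lnorm_fine mb boo) (Lnorm_pushes p1 measurable_snd pi2)//.
  exact/measurable_EFinP.
apply: fine_dist_le; rewrite ?Lnorm_ge0 ?aE ?bE //.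
- apply: (Lnorm_triangle pi p1 mabu mbu) => u; rewrite normr_id.
  rewrite distrC -[in leLHS](subrK (fine (b u.2)) (fine (a u.1))).
  exact: ler_normD.
- apply: (Lnorm_triangle pi p1 mabu mau) => u; rewrite normr_id.
  rewrite -[in leLHS](subrK (fine (a u.1)) (fine (b u.2))).
  exact: ler_normD.
Qed.

End eccentricity.

(** * Lower bounds for a pair of functions of two variables *)

Section network_pair.
Context {d1 d2 : measure_display} {T1 : measurableType d1}
  {T2 : measurableType d2} {R : realType} {Z : completeMetricType R}.
Variables (m1 : probability T1 R) (m2 : probability T2 R).
Variables (f : T1 * T1 -> borel Z) (g : T2 * T2 -> borel Z).
Hypotheses (mf : measurable_fun setT f) (mg : measurable_fun setT g).
Variables (p : \bar R) (p1 : 1 <= p) (sepZ : separable Z) (z0 : Z).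
Local Notation dist := (@mdist R Z).

(** The two variables of a network function are separated: u and v are pairs of
    points of the two spaces, so that fixing u gives the integrand of the
    pairwise eccentricity. *)
Definition cost (u v : T1 * T2) : \bar R :=
  (dist (f (u.1, v.1)) (g (u.2, v.2)))%:E.

Lemma measurable_cost :
  measurable_fun setT (fun w : (T1 * T2) * (T1 * T2) => cost w.1 w.2).
Proof.
apply: (measurableT_comp (measurable_mdist_pair z0 sepZ)
  (g := fun w : (T1 * T2) * (T1 * T2) =>
    (f (w.1.1, w.2.1), g (w.1.2, w.2.2)))).
apply: measurable_fun_pair.
  apply: (measurableT_comp mf); apply: measurable_fun_pair.
    exact: (measurableT_comp measurable_fst).
  exact: (measurableT_comp measurable_fst measurable_snd).
apply: (measurableT_comp mg); apply: measurable_fun_pair.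
  exact: (measurableT_comp measurable_snd measurable_fst).
exact: (measurableT_comp measurable_snd measurable_snd).
Qed.

(** The coupling pi itself competes in the infimum over couplings inside the
    left-hand side. *)
Lemma inf_coupling_cost_le_GW :
  inf_coupling p m1 m2 (fun u => inf_coupling p m1 m2 (cost u)) <=
  ereal_inf [set 'N[(pi \x pi)]_p[(fun w => cost w.1 w.2)]
    | pi in coupling m1 m2].
Proof.
apply: le_ereal_inf_tmp => _ [pi cpi <-].
apply: ge_ereal_inf; exists 'N[pi]_p[(fun u => inf_coupling p m1 m2 (cost u))].
  by exists pi.
rewrite (Lnorm_fubini _ _ p1 measurable_cost).
apply: le_Lnorm => // u.
rewrite !gee0_abs ?Lnorm_ge0 ?inf_coupling_ge0//.
by apply: ge_ereal_inf; exists 'N[pi]_p[cost u] => //; exists pi.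
Qed.

Let eccf x := 'N[m1]_p[(fun x' => (dist (f (x, x')) z0)%:E)].
Let eccg y := 'N[m2]_p[(fun y' => (dist (g (y, y')) z0)%:E)].

(** Under any coupling q the eccentricities at u are norms of the distances to
    z0, and the triangle inequality through the other value compares them. *)
Lemma fine_ecc_dist_le_cost u :
  (`|fine (eccf u.1) - fine (eccg u.2)|)%:E <= inf_coupling p m1 m2 (cost u).
Proof.
apply: le_ereal_inf_tmp => _ [q [q1 q2] <-].
have mfx : measurable_fun setT (fun x' => (dist (f (u.1, x')) z0)%:E).
  exact: (measurableT_comp (measurable_mdist z0)
    (measurableT_comp mf (pair1_measurable u.1))).
have mgy : measurable_fun setT (fun y' => (dist (g (u.2, y')) z0)%:E).
  exact: (measurableT_comp (measurable_mdist z0)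
    (measurableT_comp mg (pair1_measurable u.2))).
have mc : measurable_fun setT (cost u).
  exact: (measurableT_comp measurable_cost (pair1_measurable u)).
have mfq : measurable_fun setT (fun v : T1 * T2 => dist (f (u.1, v.1)) z0).
  by apply/measurable_EFinP; exact: (measurableT_comp mfx).
have mgq : measurable_fun setT (fun v : T1 * T2 => dist (g (u.2, v.2)) z0).
  by apply/measurable_EFinP; exact: (measurableT_comp mgy).
have {}mc : measurable_fun setT
    (fun v : T1 * T2 => dist (f (u.1, v.1)) (g (u.2, v.2))).
  exact/measurable_EFinP.
rewrite /eccf /eccg (Lnorm_pushes p1 measurable_fst q1 mfx).
rewrite (Lnorm_pushes p1 measurable_snd q2 mgy).
apply: fine_dist_le; rewrite ?Lnorm_ge0//.
- apply: (Lnorm_triangle q p1 mc mgq) => v.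
  by rewrite !(ger0_norm (mdist_ge0 _ _)) metric_triangle.
- apply: (Lnorm_triangle q p1 mc mfq) => v.
  rewrite !(ger0_norm (mdist_ge0 _ _)) (metric_sym (f _) (g _)).
  exact: metric_triangle.
Qed.

End network_pair.

(** * The chain of lower bounds *)

Lemma pushes_swap d1 d2 (T1 : measurableType d1) (T2 : measurableType d2)
    (R : realType) (m1 : probability T1 R) (m2 : probability T2 R) :
  pushes (m1 \x m2) (fun u => (u.2, u.1)) (m2 \x m1).
Proof.
move=> A mA; have msw := @measurable_swap _ _ T1 T2.
have [n pn] := ex_pushes (m1 \x m2) msw.
rewrite (pn _ mA); apply/esym.
apply: (product_measure_unique (m' := n)) => // B C mB mC.
have pre : (fun u : T1 * T2 => (u.2, u.1)) @^-1` (B `*` C) = C `*` B.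
  by apply/seteqP; split=> -[x y] [].
have nE : (m1 \x m2) (C `*` B) = n (B `*` C).
  by rewrite -pre pn//; exact: measurableX.
apply: etrans (esym nE) _; apply: etrans (product_measure1E _ _ mC mB) _.
exact: muleC.
Qed.

Lemma Lnorm_swap d1 d2 (T1 : measurableType d1) (T2 : measurableType d2)
    (R : realType) (m1 : probability T1 R) (m2 : probability T2 R) p
    (h : T2 * T1 -> \bar R) : 1 <= p -> measurable_fun setT h ->
  'N[(m1 \x m2)]_p[(fun u => h (u.2, u.1))] = 'N[(m2 \x m1)]_p[h].
Proof.
move=> p1 mh; rewrite [RHS](Lnorm_pushes p1 _ (pushes_swap m1 m2))//.
exact: measurable_swap.
Qed.

Section chain.
Context {d1 d2 : measure_display} {T1 : measurableType d1}
  {T2 : measurableType d2} {R : realType} {Z : completeMetricType R}.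
Variables (m1 : probability T1 R) (m2 : probability T2 R).
Variables (f : T1 * T1 -> borel Z) (g : T2 * T2 -> borel Z).
Hypotheses (mf : measurable_fun setT f) (mg : measurable_fun setT g).
Variables (p : \bar R) (p1 : 1 <= p) (sepZ : separable Z) (z0 : Z).
Local Notation dist := (@mdist R Z).

(** The coupling of the squares is the image of pi \x pi under the exchange of
    the two middle coordinates. *)
Lemma inf_coupling_square_le_GW :
  inf_coupling p (m1 \x m1) (m2 \x m2)
    (fun u => (dist (f u.1) (g u.2))%:E) <=
  ereal_inf [set 'N[(pi \x pi)]_p[(fun w => cost f g w.1 w.2)]
    | pi in coupling m1 m2].
Proof.
apply: le_ereal_inf_tmp => _ [pi [pi1 pi2] <-].
pose shuffle (w : (T1 * T2) * (T1 * T2)) := ((w.1.1, w.2.1), (w.1.2, w.2.2)).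
have m11 : measurable_fun setT (fun w : (T1 * T2) * (T1 * T2) => (w.1.1, w.2.1)).
  apply: measurable_fun_pair; exact: (measurableT_comp measurable_fst).
have m22 : measurable_fun setT (fun w : (T1 * T2) * (T1 * T2) => (w.1.2, w.2.2)).
  apply: measurable_fun_pair; exact: (measurableT_comp measurable_snd).
have mshuffle : measurable_fun setT shuffle by exact: measurable_fun_pair.
have [sigma psigma] := ex_pushes (pi \x pi) mshuffle.
apply: ge_ereal_inf.
exists 'N[sigma]_p[(fun u => (dist (f u.1) (g u.2))%:E)].
  exists sigma => //; split=> A mA.
    rewrite -psigma; last exact: (measurable_preimage measurable_fst).
    exact: (pushes_prod measurable_fst measurable_fst pi1 pi1 mA).
  rewrite -psigma; last exact: (measurable_preimage measurable_snd).
  exact: (pushes_prod measurable_snd measurable_snd pi2 pi2 mA).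
rewrite (Lnorm_pushes p1 mshuffle psigma)//.
apply: (measurableT_comp (measurable_mdist_pair z0 sepZ)
  (g := fun u : (T1 * T1) * (T2 * T2) => (f u.1, g u.2))).
apply: measurable_fun_pair.
  exact: (measurableT_comp mf).
exact: (measurableT_comp mg).
Qed.

Let eccf x := 'N[m1]_p[(fun x' => (dist (f (x, x')) z0)%:E)].
Let eccg y := 'N[m2]_p[(fun y' => (dist (g (y, y')) z0)%:E)].
Let sizef := 'N[(m1 \x m1)]_p[(fun u => (dist (f u) z0)%:E)].
Let sizeg := 'N[(m2 \x m2)]_p[(fun u => (dist (g u) z0)%:E)].
Hypotheses (sizef_lty : sizef < +oo) (sizeg_lty : sizeg < +oo).
Variables (F : {mfun T1 >-> borel R^o}) (G : {mfun T2 >-> borel R^o}).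
Hypotheses (FE : forall x, F x = fine (eccf x)) (GE : forall y, G y = fine (eccg y)).

(** The functions F and G stand for the real-valued eccentricities, with their
    measurability, from which the image laws on the line are built. *)
Lemma ecc_chain :
  [/\ inf_coupling p m1 m2 (fun u => inf_coupling p m1 m2 (cost f g u)) <=
      ereal_inf [set 'N[(pi \x pi)]_p[(fun w => cost f g w.1 w.2)]
        | pi in coupling m1 m2],
      inf_coupling p m1 m2 (fun u => eccf u.1 - eccg u.2) <=
      inf_coupling p m1 m2 (fun u => inf_coupling p m1 m2 (cost f g u)),
      inf_coupling p m1 m2 (fun u => eccf u.1 - eccg u.2) =
      Wasserstein p (distribution m1 F) (distribution m2 G) &
      `|sizef - sizeg| <= Wasserstein p (distribution m1 F) (distribution m2 G)].
Proof.
have mdf : measurable_fun setT (fun u => (dist (f u) z0)%:E).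
  exact: (measurableT_comp (measurable_mdist z0) mf).
have mdg : measurable_fun setT (fun u => (dist (g u) z0)%:E).
  exact: (measurableT_comp (measurable_mdist z0) mg).
have mef : measurable_fun setT eccf by exact: (measurable_Lnorm_lsection m1 p mdf).
have meg : measurable_fun setT eccg by exact: (measurable_Lnorm_lsection m2 p mdg).
have sfE : sizef = 'N[m1]_p[eccf] by exact: Lnorm_fubini.
have sgE : sizeg = 'N[m2]_p[eccg] by exact: Lnorm_fubini.
have efoo : 'N[m1]_p[eccf] < +oo by rewrite -sfE.
have egoo : 'N[m2]_p[eccg] < +oo by rewrite -sgE.
have sepR : separable (R^o : completeMetricType R).
  exists (@ratr R @` setT); last exact: dense_rat.
  exact: (sub_countable (card_image_le _ _)).
have WE : Wasserstein p (distribution m1 F) (distribution m2 G) =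
    inf_coupling p m1 m2 (fun u => (`|fine (eccg u.2) - fine (eccf u.1)|)%:E).
  rewrite -(inf_coupling_Wasserstein m1 m2 F G (0%R : R^o))//.
  by congr inf_coupling; apply/funext => u; rewrite FE GE.
split.
- exact: (inf_coupling_cost_le_GW _ _ mf mg p1 sepZ z0).
- apply: le_inf_coupling => pi cpi.
  rewrite (Lnorm_fineB p1 mef meg efoo egoo cpi).
  apply: le_Lnorm => // u; rewrite gee0_abs ?lee_fin// gee0_abs ?inf_coupling_ge0//.
  by rewrite distrC; exact: fine_ecc_dist_le_cost.
- rewrite WE; apply/eqP; rewrite eq_le; apply/andP; split;
    apply: le_inf_coupling => pi cpi;
    by rewrite (Lnorm_fineB p1 mef meg efoo egoo cpi).
- by rewrite WE sfE sgE; exact: dist_Lnorm_le_inf_coupling.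
Qed.

End chain.

(** Finiteness of the size, assumed for one base point, holds for z0 by the
    triangle inequality, as constants have finite norm for a probability. *)
Lemma size_at_lty (R : realType) (Z : completeMetricType R) (p : \bar R)
    (p1 : 1 <= p) (z0 : Z) (X : network Z p) : size_at z0 X < +oo.
Proof.
have [z1 z1oo] := omega_Lp X.
have mo : measurable_fun setT (omega X) by exact: measurable_funPT.
have m1 : measurable_fun setT (fun u => mdist (omega X u) z1).
  by apply/measurable_EFinP; exact: (measurableT_comp (measurable_mdist z1) mo).
apply: (@le_lt_trans _ _ ('N[(mu X \x mu X)]_p[EFin \o (fun u => mdist (omega X u) z1)] +
    'N[(mu X \x mu X)]_p[EFin \o cst (mdist z1 z0)])).
  apply: Lnorm_triangle => // u.
  by rewrite !(ger0_norm (mdist_ge0 _ _)) metric_triangle.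
by rewrite (Lnorm_cst _ (mdist z1 z0)%:E p1) lte_add_pinfty//= ltry.
Qed.

Theorem theorem49 (R : realType) (Z : completeMetricType R)
    (sepZ : separable Z) (z0 : Z) (p : \bar R) (p1 : 1 <= p)
    (X Y : network Z p) :
  let half_inf (f : borel X * borel Y -> \bar R) :=
    2^-1%:E * inf_coupling p (mu X) (mu Y) f in
  [/\ GW X Y >= half_inf (ecc2_out X Y),
      half_inf (ecc2_out X Y) =
        half_inf (fun u => Wasserstein p (law_out X u.1) (law_out Y u.2)),
      half_inf (fun u => Wasserstein p (law_out X u.1) (law_out Y u.2)) >=
        half_inf (fun u => ecc_out z0 X u.1 - ecc_out z0 Y u.2),
      half_inf (fun u => ecc_out z0 X u.1 - ecc_out z0 Y u.2) =
        2^-1%:E * Wasserstein p (ecc_law_out z0 X) (ecc_law_out z0 Y)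
    & 2^-1%:E * Wasserstein p (ecc_law_out z0 X) (ecc_law_out z0 Y) >=
        2^-1%:E * `|size_at z0 X - size_at z0 Y| ] /\
  (GW X Y >= 2^-1%:E * inf_coupling p (mu X \x mu X) (mu Y \x mu Y)
       (fun u => (@mdist R Z (omega X u.1) (omega Y u.2))%:E) /\
   2^-1%:E * inf_coupling p (mu X \x mu X) (mu Y \x mu Y)
       (fun u => (@mdist R Z (omega X u.1) (omega Y u.2))%:E) =
     2^-1%:E * Wasserstein p (law X) (law Y)) /\
  [/\ GW X Y >= half_inf (ecc2_in X Y),
      half_inf (ecc2_in X Y) =
        half_inf (fun u => Wasserstein p (law_in X u.1) (law_in Y u.2)),
      half_inf (fun u => Wasserstein p (law_in X u.1) (law_in Y u.2)) >=
        half_inf (fun u => ecc_in z0 X u.1 - ecc_in z0 Y u.2),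
      half_inf (fun u => ecc_in z0 X u.1 - ecc_in z0 Y u.2) =
        2^-1%:E * Wasserstein p (ecc_law_in z0 X) (ecc_law_in z0 Y)
    & 2^-1%:E * Wasserstein p (ecc_law_in z0 X) (ecc_law_in z0 Y) >=
        2^-1%:E * `|size_at z0 X - size_at z0 Y| ].
Proof.
move=> half_inf.
have halfge0 : (0 <= 2^-1%:E :> \bar R) by rewrite lee_fin invr_ge0.
have half_le (a b : \bar R) : a <= b -> 2^-1%:E * a <= 2^-1%:E * b.
  by move=> ab; exact: lee_wpmul2l.
have mX : measurable_fun setT (omega X) by exact: measurable_funPT.
have mY : measurable_fun setT (omega Y) by exact: measurable_funPT.
have sX := size_at_lty p1 z0 X; have sY := size_at_lty p1 z0 Y.
have [GWo Wo Eo So] := ecc_chain mX mY p1 sepZ sX sY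
  (F := fine_ecc_out z0 X) (G := fine_ecc_out z0 Y)
  (fun=> erefl) (fun=> erefl).
have msw d (T : measurableType d) : measurable_fun setT (fun u : T * T => (u.2, u.1)).
  exact: measurable_swap.
have mXs := measurableT_comp mX (msw _ (borel X)).
have mYs := measurableT_comp mY (msw _ (borel Y)).
have sXE : 'N[(mu X \x mu X)]_p[(fun u => (mdist (omega X (u.2, u.1)) z0)%:E)] =
    size_at z0 X.
  apply: (Lnorm_swap (mu X) (mu X) (h := fun u => (mdist (omega X u) z0)%:E) p1).
  exact: (measurableT_comp (measurable_mdist z0) mX).
have sYE : 'N[(mu Y \x mu Y)]_p[(fun u => (mdist (omega Y (u.2, u.1)) z0)%:E)] =
    size_at z0 Y.
  apply: (Lnorm_swap (mu Y) (mu Y) (h := fun u => (mdist (omega Y u) z0)%:E) p1).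
  exact: (measurableT_comp (measurable_mdist z0) mY).
have sXs := sX; rewrite -sXE in sXs; have sYs := sY; rewrite -sYE in sYs.
have [GWi Wi Ei Si] := ecc_chain mXs mYs p1 sepZ sXs sYs
  (F := fine_ecc_in z0 X) (G := fine_ecc_in z0 Y)
  (fun=> erefl) (fun=> erefl).
have GWE : ereal_inf [set 'N[(pi \x pi)]_p[(fun w =>
        cost (omega X \o (fun u => (u.2, u.1))) (omega Y \o (fun u => (u.2, u.1)))
          w.1 w.2)] | pi in coupling (mu X) (mu Y)] =
    ereal_inf [set 'N[(pi \x pi)]_p[(fun w => cost (omega X) (omega Y) w.1 w.2)]
      | pi in coupling (mu X) (mu Y)].
  congr ereal_inf; apply: eq_imagel => pi _.
  exact: (Lnorm_swap pi pi p1 (measurable_cost mX mY sepZ z0)).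
have W2o : ecc2_out X Y =
    fun u => Wasserstein p (law_out X u.1) (law_out Y u.2).
  apply/funext => u.
  exact: (inf_coupling_Wasserstein (mu X) (mu Y) (lsection (omega X) u.1)
    (lsection (omega Y) u.2) z0 sepZ p1).
have W2i : ecc2_in X Y =
    fun u => Wasserstein p (law_in X u.1) (law_in Y u.2).
  apply/funext => u.
  exact: (inf_coupling_Wasserstein (mu X) (mu Y) (rsection (omega X) u.1)
    (rsection (omega Y) u.2) z0 sepZ p1).
split; [|split; [split|]].
- split.
  + exact: half_le GWo.
  + by rewrite W2o.
  + rewrite -W2o; exact: half_le Wo.
  + by congr (_ * _); exact: Eo.
  + exact: half_le So.
- apply: half_le; exact: (inf_coupling_square_le_GW (mu X) (mu Y) mX mY p1 sepZ z0).
- congr (_ * _); exact: (inf_coupling_Wasserstein (mu X \x mu X) (mu Y \x mu Y)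
    (omega X) (omega Y) z0 sepZ p1).
- rewrite /GW -GWE -sXE -sYE; split.
  + exact: half_le GWi.
  + by rewrite W2i.
  + rewrite -W2i; exact: half_le Wi.
  + by congr (_ * _); exact: Ei.
  + exact: half_le Si.
Qed.
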